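(* Let $S$ be a finite set, $M=(m_{s,t})_{s,t\in S}$ a Coxeter matrix over $S$, and $A_S$ the associated Artin group. Then $A_S$ is parabolic-retractable if and only if, for every triple $a,b,c\in S$ of pairwise distinct elements, the standard parabolic subgroup $A_{\{a,b,c\}}$ admits a retraction onto $A_{\{b,c\}}$.
   Context: A Coxeter matrix over a finite set $S$ is a matrix $M=(m_{s,t})_{s,t\in S}$ with entries in $\mathbb{N}\cup\{\infty\}$, $m_{s,s}=1$, and $m_{s,t}=m_{t,s}\ge 2$ for $s\neq t$. Write $\Pi(s,t,m)$ for the alternating word $sts\cdots$ of length $m$. The Artin group of $M$ is $A_S=\langle S\mid \Pi(s,t,m_{s,t})=\Pi(t,s,m_{s,t})$ for $s\neq t$, $m_{s,t}\neq\infty\rangle$. For $X\subseteq S$, the standard parabolic subgroup $A_X$ is the subgroup generated by $X$ (it is the Artin group of the submatrix of $M$ indexed by $X$). A retraction of a group $G$ onto a subgroup $H$ is a homomorphism $\varphi:G\to H$ with $\varphi|_H=\mathrm{id}_H$. $A_S$ is called parabolic-retractable if it admits a retraction onto $A_X$ for every $X\subseteq S$. *)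

(* Defs.v *)
(* Artin groups are encoded concretely by a presentation:
   elements are words in the letters S^{+-1}, modulo the congruence [aeq]
   generated by free cancellation and the Artin relations. *)
From mathcomp Require Import all_boot.
Set Implicit Arguments. Unset Strict Implicit. Unset Printing Implicit Defensive.

Section Artin.
Variable S : finType.

(* entries in N u {oo}: [Some k] = k, [None] = oo *)
Definition coxeter_matrix (m : S -> S -> option nat) : Prop :=
  (forall s, m s s = Some 1) /\
  (forall s t, m s t = m t s) /\
  (forall s t, s != t -> match m s t with Some k => 2 <= k | None => true end).

(* a letter (x, false) is the generator x, (x, true) is its inverse *)
Definition letter := (S * bool)%type.
Definition word := seq letter.

Definition Pi (s t : S) (k : nat) : word :=
  mkseq (fun i => (if odd i then t else s, false)) k.

(* congruence on words whose quotient is the Artin group A_S *)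
Inductive aeq (m : S -> S -> option nat) : word -> word -> Prop :=
| aeq_refl w : aeq m w w
| aeq_sym u v : aeq m u v -> aeq m v u
| aeq_trans u v w : aeq m u v -> aeq m v w -> aeq m u w
| aeq_free u x b v : aeq m (u ++ (x, b) :: (x, ~~ b) :: v) (u ++ v)
| aeq_rel u v s t k : s != t -> m s t = Some k ->
    aeq m (u ++ Pi s t k ++ v) (u ++ Pi t s k ++ v).

(* words all of whose letters lie in X: their classes form A_X *)
Definition wordin (X : {set S}) (w : word) : bool := all (fun l => l.1 \in X) w.

(* For X \subset Y, [retraction m Y X]: there is a retraction of the
   subgroup A_Y of A_S onto its subgroup A_X, i.e. a group homomorphism
   phi : A_Y -> A_X with phi|_{A_X} = id.  phi is represented by a map f on
   words (only its values on Y-words matter). *)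
Definition retraction (m : S -> S -> option nat) (Y X : {set S}) : Prop :=
  exists f : word -> word,
    (forall u v, wordin Y u -> wordin Y v -> aeq m u v -> aeq m (f u) (f v)) /\
    (forall u v, wordin Y u -> wordin Y v -> aeq m (f (u ++ v)) (f u ++ f v)) /\
    (forall u, wordin Y u -> exists w, wordin X w /\ aeq m (f u) w) /\
    (forall u, wordin X u -> aeq m (f u) u).

Definition parabolic_retractable (m : S -> S -> option nat) : Prop :=
  forall X : {set S}, retraction m [set: S] X.

End Artin.

(* Main.v *)
(** The dihedral case drives everything.  A retraction [A_{a,b,c} -> A_{b,c}]
    with [p = m_ab] odd and [q = m_ac] finite forces [r = m_bc] to be finite with
    [r | p] or [r | q].  To see this, let [A_S] act by transvections for an
    alternating form with [|omega s t| = 2 cos (pi / m_st)] ([2] if [m_st = oo]):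
    two transvections satisfy the braid relation of length [n] exactly when their
    pairing [mu] satisfies [mu U_n(mu) = 0], with [U_n] the Chebyshev polynomial
    such that [U_n (2 cos t) = sin (n t) / sin t].  As [p] is odd, the image of [a]
    is conjugate to [b] in [A_{b,c}], so it acts as the transvection along a vector
    [(x, y)] of the Hecke group orbit of [(1, 0)]; both pairings must be less than
    [2] in absolute value, and this leaves only [(1, 0)] and [(0, 1)] up to sign
    (for [r >= 4]; the cases [r = 2, 3, oo] are treated by hand), whence the
    divisibility.  This way no injectivity of [A_{b,c} -> A_S] is needed.

    Conversely, to retract [A_{X + a}] onto [A_X], send [a] to [1] if all the
    [m_ax] are even or infinite, and otherwise to the [b] in [X] minimizing the odd
    values of [m_ab]: applied also to the triple with [a] and [b] exchanged,
    the divisibility gives [m_bc | m_ac] for all [c] in [X] with [m_ac] finite. *)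
From Stdlib Require Import Reals Lra FunctionalExtensionality.
Require Import Defs.
From mathcomp Require Import all_boot zify.
Set Implicit Arguments. Unset Strict Implicit. Unset Printing Implicit Defensive.
Delimit Scope R_scope with R.

(** * Chebyshev polynomials and pairs of transvections *)

Fixpoint cheb (mu : R) (n : nat) : R :=
  if n is n'.+1 then
    (if n' is n''.+1 then mu * cheb mu n' - cheb mu n'' else 1)%R
  else 0%R.

Lemma chebSS mu n : cheb mu n.+2 = (mu * cheb mu n.+1 - cheb mu n)%R.
Proof. by []. Qed.

Definition sgn_odd (n : nat) : R := if odd n then (-1)%R else 1%R.

Lemma sgn_oddS n : sgn_odd n.+1 = (- sgn_odd n)%R.
Proof. by rewrite /sgn_odd /=; case: odd => /=; lra. Qed.

Lemma cheb_opp mu n : cheb (- mu) n = (- sgn_odd n * cheb mu n)%R.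
Proof.
suff: cheb (- mu) n = (- sgn_odd n * cheb mu n)%R /\
      cheb (- mu) n.+1 = (- sgn_odd n.+1 * cheb mu n.+1)%R by case.
elim: n => [|n [IH1 IH2]]; first by rewrite /sgn_odd /=; split; lra.
split=> //; rewrite chebSS IH1 IH2 chebSS !sgn_oddS; ring.
Qed.

Lemma cheb_abs mu n : cheb mu n = 0%R -> cheb (Rabs mu) n = 0%R.
Proof.
move=> h; rewrite /Rabs; case: Rcase_abs => _ //.
by rewrite cheb_opp h; ring.
Qed.

(** The increments start at [1] and do not decrease: two consecutive ones differ by
    [(mu - 2) * cheb mu n.+1], which is nonnegative. *)
Lemma cheb_ge2 mu n : (2 <= mu)%R -> (cheb mu n + 1 <= cheb mu n.+1)%R.
Proof.
move=> h; suff: (0 <= cheb mu n)%R /\ (cheb mu n + 1 <= cheb mu n.+1)%R by case.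
elim: n => [|n [IH1 IH2]]; first by simpl; lra.
split; first lra; rewrite chebSS; nra.
Qed.

Lemma cheb_root_lt2 mu n : 0 < n -> cheb mu n = 0%R -> (Rabs mu < 2)%R.
Proof.
case: n => // n _ /cheb_abs h; apply: Rnot_le_lt => h2.
have: (0 <= cheb (Rabs mu) n)%R.
  by elim: n {h} => [|n IH] /=; [lra | have := cheb_ge2 n h2; simpl; lra].
have := cheb_ge2 n h2; lra.
Qed.

Fixpoint alt (V : Type) (k : nat) (F G : V -> V) (v : V) : V :=
  if k is k'.+1 then alt k' G F (F v) else v.

(* The values of the two functionals of a [transv_pair] along an alternating
   product, the sequence [z_0 = y, z_1 = x, z_2 = y - mu x, z_3 = x + mu z_2, ...]. *)
Fixpoint zseq (mu x y : R) (n : nat) : R :=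
  if n is n'.+1 then zseq (- mu) (y - mu * x) x n' else y.

(** The sign [(-1)^(n(n-1)/2)] accumulated because each step of [zseq] changes [mu] into [- mu]. *)
Fixpoint zsgn (n : nat) : R := if n is n'.+1 then (sgn_odd n' * zsgn n')%R else 1%R.

Lemma zsgn_neq0 n : zsgn n <> 0%R.
Proof.
elim: n => [|n IH] /=; first lra.
by rewrite /sgn_odd; case: odd; lra.
Qed.

Lemma zseqS mu x y n :
  zseq mu x y n.+1 = (zsgn n.+1 * (cheb mu n.+1 * x - cheb mu n * y))%R.
Proof.
elim: n mu x y => [|n IH] mu x y; first by rewrite /= /sgn_odd /=; ring.
have -> : zseq mu x y n.+2 = zseq (- mu) (y - mu * x) x n.+1 by [].
have -> : zsgn n.+2 = (- sgn_odd n * zsgn n.+1)%R by rewrite -sgn_oddS.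
rewrite IH !cheb_opp chebSS sgn_oddS; ring.
Qed.

Section Transvections.
Variable V : Type.

(** [F] and [G] stand for [v + a v * e] and [v + b v * e'], where [b e = - mu] and [a e' = mu].
    Recording only their effect on [a] and [b] lets [V] be any type. *)
Definition transv_pair (F G : V -> V) (a b : V -> R) (mu : R) :=
  [/\ forall v, a (F v) = a v, forall v, b (F v) = (b v - mu * a v)%R,
      forall v, b (G v) = b v & forall v, a (G v) = (a v + mu * b v)%R].

Lemma transv_pair_sym F G a b mu :
  transv_pair F G a b mu -> transv_pair G F b a (- mu).
Proof.
case=> aF bF bG aG; split=> // v; [rewrite aG | rewrite bF]; ring.
Qed.

Lemma alt_coord F G a b mu k v : transv_pair F G a b mu ->
  let z := zseq mu (a v) (b v) in
  a (alt k F G v) = z (if odd k then k else k.+1) /\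
  b (alt k F G v) = z (if odd k then k.+1 else k).
Proof.
elim: k F G a b mu v => [|k IH] F G a b mu v H; first by [].
have [aF bF _ _] := H.
have [h1 h2] := IH _ _ _ _ _ (F v) (transv_pair_sym H).
move: h1 h2; rewrite aF bF /= => -> ->.
by case: (odd k).
Qed.

(** In each difference the signs cancel one of [a v], [b v]; the other gets the coefficient
    [cheb mu k.+1 + cheb mu k.-1], which is [mu * cheb mu k]. *)
Lemma alt_diff F G a b mu k v : transv_pair F G a b mu ->
  exists e1 e2 : R, [/\ e1 <> 0%R, e2 <> 0%R,
   (a (alt k F G v) - a (alt k G F v) =
     e1 * (mu * cheb mu k) * (if odd k then b v else a v))%R &
   (b (alt k F G v) - b (alt k G F v) =
     e2 * (mu * cheb mu k) * (if odd k then a v else b v))%R].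
Proof.
move=> H; case: k => [|k].
  by exists 1%R, 1%R; split=> /=; lra.
have [-> ->] := alt_coord k.+1 v H.
have [-> ->] := alt_coord k.+1 v (transv_pair_sym H).
have z1 := @zsgn_neq0 k.+1; have z2 := @zsgn_neq0 k.+2.
have ez : zsgn k.+2 = (- sgn_odd k * zsgn k.+1)%R by rewrite -sgn_oddS.
have : sgn_odd k = if odd k.+1 then 1%R else (-1)%R.
  by rewrite /sgn_odd /=; case: odd.
case: (odd k.+1) => es.
- exists (- zsgn k.+1)%R, (zsgn k.+2)%R; split=> //; try lra;
    by rewrite !zseqS !cheb_opp !chebSS ez !sgn_oddS es; ring.
- exists (zsgn k.+2)%R, (- zsgn k.+1)%R; split=> //; try lra;
    by rewrite !zseqS !cheb_opp !chebSS ez !sgn_oddS es; ring.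
Qed.

Lemma alt_agree F G a b mu k v : transv_pair F G a b mu ->
  alt k F G v = alt k G F v -> b v <> 0%R -> (mu * cheb mu k = 0)%R.
Proof.
move=> H e bv; have [e1 [e2 [n1 n2]]] := alt_diff k v H.
rewrite e !Rminus_diag; case: odd => [h _|_ h].
- have /Rmult_integral [/Rmult_integral []|] // := esym h.
- have /Rmult_integral [/Rmult_integral []|] // := esym h.
Qed.

Lemma alt_braid F G a b mu k v : transv_pair F G a b mu ->
  (mu * cheb mu k = 0)%R ->
  a (alt k F G v) = a (alt k G F v) /\ b (alt k F G v) = b (alt k G F v).
Proof.
move=> H e; have [e1 [e2 [_ _]]] := alt_diff k v H.
by rewrite e !Rmult_0_r !Rmult_0_l => h1 h2; split; lra.
Qed.
End Transvections.

(* At [m = oo] any value [>= 2] excludes all braid relations; [2] keeps the orbit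
   integral. *)
Definition coxlam (o : option nat) : R :=
  if o is Some k then (2 * cos (PI / INR k))%R else 2%R.

(** * Chebyshev polynomials at [2 cos (pi / r)] *)

Section Lam.
Variable r : nat.
Hypothesis r2 : 2 <= r.
Let th := (PI / INR r)%R.
Let lam := coxlam (Some r).

Lemma INR_r_gt0 : (0 < INR r)%R.
Proof. by apply: lt_0_INR; lia. Qed.

Lemma th_r : (INR r * th = PI)%R.
Proof. rewrite /th; field; have := INR_r_gt0; lra. Qed.

Lemma th_gt0 : (0 < th)%R.
Proof. apply: Rdiv_lt_0_compat; [exact: PI_RGT_0 | exact: INR_r_gt0]. Qed.

Lemma th_le : (2 * th <= PI)%R.
Proof.
rewrite -th_r; apply: Rmult_le_compat_r; first by have := th_gt0; lra.
by have -> : 2%R = INR 2 by []; apply: le_INR; lia.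
Qed.

Lemma sin_th_gt0 : (0 < sin th)%R.
Proof. by apply: sin_gt_0; have := th_gt0; have := th_le; lra. Qed.

Lemma cheb_sin n : (cheb lam n * sin th = sin (INR n * th))%R.
Proof.
suff: (cheb lam n * sin th = sin (INR n * th))%R /\
      (cheb lam n.+1 * sin th = sin (INR n.+1 * th))%R by case.
elim: n => [|n [IH1 IH2]].
  by rewrite /= !Rmult_0_l !Rmult_1_l sin_0.
split=> //; rewrite chebSS Rmult_minus_distr_r Rmult_assoc IH1 IH2.
have -> : (INR n.+2 * th = INR n.+1 * th + th)%R by rewrite (S_INR n.+1); ring.
have -> : (INR n * th = INR n.+1 * th - th)%R by rewrite (S_INR n); ring.
rewrite sin_plus sin_minus /lam /coxlam -/th; ring.
Qed.

(** The difference of the sines is [2 cos ((x + y) / 2) sin ((x - y) / 2)], and both factors are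
    nonnegative. *)
Lemma sin_ge_sym x y : (0 <= y)%R -> (y <= x)%R -> (x <= PI - y)%R ->
  (sin y <= sin x)%R.
Proof.
move=> y0 yx xp.
have hp := PI_RGT_0.
have hc : (0 <= cos ((x + y) / 2))%R by apply: cos_ge_0; lra.
have hs : (0 <= sin ((x - y) / 2))%R by apply: sin_ge_0; lra.
have ex : x = ((x + y) / 2 + (x - y) / 2)%R by field.
have ey : y = ((x + y) / 2 - (x - y) / 2)%R by field.
move: ((x + y) / 2)%R ((x - y) / 2)%R hc hs ex ey => u w hc hs -> ->.
rewrite sin_plus sin_minus; nra.
Qed.

Lemma cheb_le i k : 0 < i -> i <= k <= r - i -> (cheb lam i <= cheb lam k)%R.
Proof.
move=> i0 /andP [ik kr]; have s0 := sin_th_gt0; have t0 := th_gt0.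
apply: (Rmult_le_reg_r _ _ _ s0); rewrite !cheb_sin; apply: sin_ge_sym.
- by apply: Rmult_le_pos; [exact: pos_INR | lra].
- by apply: Rmult_le_compat_r; [lra | apply: le_INR; lia].
- have : (INR (k + i) * th <= INR r * th)%R.
    by apply: Rmult_le_compat_r; [lra | apply: le_INR; lia].
  rewrite th_r plus_INR; lra.
Qed.

Lemma cheb_ge1 k : 0 < k < r -> (1 <= cheb lam k)%R.
Proof. by move=> h; apply: (@cheb_le 1); lia. Qed.

Lemma cheb_coxlam0 : cheb lam r = 0%R.
Proof.
have s0 := sin_th_gt0; apply: (Rmult_eq_reg_r (sin th)); last lra.
by rewrite cheb_sin th_r sin_PI Rmult_0_l.
Qed.

Lemma cheb_coxlam_dvd n : cheb lam n = 0%R -> r %| n.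
Proof.
move=> h; have := cheb_sin n; rewrite h Rmult_0_l => /esym /sin_eq_0_0 [k].
rewrite -th_r -Rmult_assoc => e; have t0 := th_gt0.
have {}e : (INR n = IZR k * INR r)%R by apply: (Rmult_eq_reg_r th); lra.
move: e; rewrite !INR_IZR_INZ -mult_IZR => /eq_IZR e.
apply/dvdnP; exists (Z.to_nat k); nia.
Qed.

Lemma cheb_refl k : k <= r -> cheb lam (r - k) = cheb lam k.
Proof.
move=> kr; have s0 := sin_th_gt0; apply: (Rmult_eq_reg_r (sin th)); last lra.
rewrite !cheb_sin minus_INR; last lia.
by rewrite Rmult_minus_distr_r th_r sin_PI_x.
Qed.

Lemma coxlam_gt0 : 2 < r -> (0 < lam)%R.
Proof.
move=> r3; have : (1 <= cheb lam 2)%R by apply: cheb_ge1; lia.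
rewrite chebSS /=; lra.
Qed.
End Lam.

Lemma coxlam2 : coxlam (Some 2) = 0%R.
Proof. by rewrite /coxlam /= cos_PI2 Rmult_0_r. Qed.

Lemma coxlam3 : coxlam (Some 3) = 1%R.
Proof.
rewrite /coxlam; have -> : INR 3 = 3%R by simpl; ring.
rewrite cos_PI3; lra.
Qed.

(** * Orbits of the Hecke groups *)

Definition sgb (e : bool) : R := if e then (-1)%R else 1%R.

Inductive orb (th : R) : R -> R -> Prop :=
| orb_base : orb th 1 0
| orb_l e x y : orb th x y -> orb th (x + sgb e * th * y) y
| orb_r e x y : orb th x y -> orb th x (y + sgb e * th * x).

Lemma orb_opp th x y : orb (- th) x y -> orb th x y.
Proof.
elim=> [|e {}x {}y _ IH|e {}x {}y _ IH]; first exact: orb_base.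
- have -> : (x + sgb e * - th * y = x + sgb (~~ e) * th * y)%R.
    by case: e; rewrite /sgb /=; ring.
  exact: orb_l.
- have -> : (y + sgb e * - th * x = y + sgb (~~ e) * th * x)%R.
    by case: e; rewrite /sgb /=; ring.
  exact: orb_r.
Qed.

Lemma orb_abs th x y : orb th x y -> orb (Rabs th) x y.
Proof.
rewrite /Rabs; case: Rcase_abs => // _ h.
by apply: orb_opp; rewrite Ropp_involutive.
Qed.

(** This serves [r = 3], where the parameter is [1] and the two shears generate the modular
    group. *)
Lemma orb1_int x y : orb 1 x y ->
  exists a b : Z, [/\ x = IZR a, y = IZR b & (a, b) <> (0, 0)%Z].
Proof.
elim=> [|e {}x {}y _ [a [b [-> -> h]]]|e {}x {}y _ [a [b [-> -> h]]]].
- by exists 1%Z, 0%Z.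
- exists (if e then (a - b)%Z else (a + b)%Z), b; split=> //.
    by case: e; rewrite /sgb ?minus_IZR ?plus_IZR; ring.
  by move=> [h1 h2]; apply: h; case: e h1 => h1; congr pair; lia.
- exists a, (if e then (b - a)%Z else (b + a)%Z); split=> //.
    by case: e; rewrite /sgb ?minus_IZR ?plus_IZR; ring.
  by move=> [h1 h2]; apply: h; case: e h2 => h2; congr pair; lia.
Qed.

Lemma orb2_odd x y : orb 2 x y ->
  exists a b : Z, x = IZR (2 * a + 1) /\ y = IZR (2 * b).
Proof.
elim=> [|e {}x {}y _ [a [b [-> ->]]]|e {}x {}y _ [a [b [-> ->]]]].
- by exists 0%Z, 0%Z.
- exists (if e then (a - 2 * b)%Z else (a + 2 * b)%Z), b; split=> //.
  by case: e; rewrite /sgb !(minus_IZR, plus_IZR, mult_IZR); ring.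
- exists a, (if e then (b - (2 * a + 1))%Z else (b + (2 * a + 1))%Z); split=> //.
  by case: e; rewrite /sgb !(minus_IZR, plus_IZR, mult_IZR); ring.
Qed.

Lemma orb0E x y : orb 0 x y -> x = 1%R /\ y = 0%R.
Proof. by elim=> [|e {}x {}y _ [-> ->]|e {}x {}y _ [-> ->]]; split; ring. Qed.

Section Hecke.
Variable r : nat.
Hypothesis r4 : 4 <= r.
Let lam := coxlam (Some r).
Let U := cheb lam.

(* The vectors [(U k.+1, U k)], [k < r], are the successive images of [(1, 0)] under
   the rotation [(x, y) |-> (lam x - y, x)] of order [2r].  They cut the first
   quadrant into [r - 1] cones, each of them the image of the whole quadrant under
   an element of the Hecke group; [tree] is the part of the orbit in the quadrant. *)
Inductive tree : R -> R -> Prop :=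
| tree_e1 : tree 1 0
| tree_e2 : tree 0 1
| tree_step k x y : k <= r - 2 -> tree x y ->
    tree (x * U k.+1 + y * U k.+2) (x * U k + y * U k.+1).

Let Ur : U r = 0%R. Proof. by apply: cheb_coxlam0; lia. Qed.
Let Ur1 : U r.-1 = 1%R.
Proof. by rewrite /U /lam -subn1 cheb_refl //; lia. Qed.
Let Ur2 : U r.-2 = lam.
Proof.
by rewrite /U /lam -subn2 cheb_refl; [rewrite /=; ring | lia | lia].
Qed.
Let U2 : U 2 = lam. Proof. by rewrite /U /=; ring. Qed.

(** In the last case [lam * x] or [lam * y] is at least [lam * lam >= 2], too large for a pairing of
    vectors whose transvections satisfy a braid relation. *)
Definition small_or_big (x y : R) : Prop :=
  [\/ x = 0%R /\ y = 1%R, x = 1%R /\ y = 0%R |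
      (1 <= x /\ 1 <= y /\ (lam <= x \/ lam <= y))%R].

Let U_ge0 k : k <= r -> (0 <= U k)%R.
Proof.
case: k => [|k] kr; first by rewrite /U /=; lra.
have [/eqP ->|kr'] := boolP (k.+1 == r); first by rewrite Ur; lra.
have : (1 <= U k.+1)%R by apply: cheb_ge1; lia.
lra.
Qed.

Let polygon k : k < r -> small_or_big (U k.+1) (U k).
Proof.
move=> kr; have [->|k0] := posnP k; first by constructor 2.
have [e|e] := eqVneq k r.-1.
  by constructor 1; rewrite e Ur1 -Ur; split=> //; congr (U _); lia.
constructor 3; split; first by apply: cheb_ge1; lia.
split; first by apply: cheb_ge1; lia.
rewrite -{1 2}U2; have [->|k1] := eqVneq k 1; first by left; rewrite U2; lra.
by right; apply: cheb_le; lia.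
Qed.

Lemma tree_small_or_big x y : tree x y -> small_or_big x y.
Proof.
elim=> [||k {}x {}y kr _ IH]; [by constructor 2|by constructor 1|].
case: IH => [[-> ->]|[-> ->]|[x1 [y1 _]]].
- by rewrite !Rmult_0_l !Rmult_1_l !Rplus_0_l; apply: polygon; lia.
- by rewrite !Rmult_0_l !Rmult_1_l !Rplus_0_r; apply: polygon; lia.
have h0 : (0 <= U k)%R by apply: U_ge0; lia.
have h1 : (1 <= U k.+1)%R by apply: cheb_ge1; lia.
have h2 : (0 <= U k.+2)%R by apply: U_ge0; lia.
constructor 3; split; first by nra.
split; first by nra.
have [e|k0] := posnP k.
  by left; move: h1 h2; rewrite e U2 => h1 h2; nra.
have [e|ke] := eqVneq k r.-2.
  by right; move: h0 h1; rewrite e Ur2 => h0 h1; nra.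
left; have : (lam <= U k.+1)%R by rewrite -U2; apply: cheb_le; lia.
nra.
Qed.

(** One case per quadrant: some quarter turn brings the vector into the tree. *)
Definition signed_tree (x y : R) : Prop :=
  [\/ tree x y, tree (- x) (- y), tree y (- x) | tree (- y) x].

Let steq x y x' y' : signed_tree x y -> x = x' -> y = y' -> signed_tree x' y'.
Proof. by move=> h <- <-. Qed.

Let treq x y x' y' : tree x y -> x = x' -> y = y' -> tree x' y'.
Proof. by move=> h <- <-. Qed.

Lemma signed_tree_quarter x y : signed_tree x y -> signed_tree (- y) x.
Proof.
case=> h; [constructor 3|constructor 4|constructor 2|constructor 1];
  by apply: (treq h); ring.
Qed.

Let st_opp x y : signed_tree x y -> signed_tree (- x) (- y).
Proof.
by move=> /signed_tree_quarter /signed_tree_quarter h; apply: (steq h); ring.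
Qed.

(** The rotation sends cone [k] to cone [k.+1], and the last cone onto the whole second quadrant,
    which is constructor 3. *)
Let tree_R x y : tree x y -> signed_tree (lam * x - y) x.
Proof.
case=> [||k {}x {}y kr h].
- constructor 1; apply: (treq (tree_step (k := 0) _ tree_e2)) => //.
  + by rewrite U2; ring.
  + by rewrite /U /=; ring.
- by constructor 2; apply: (treq tree_e1); ring.
have [e|e] := eqVneq k (r - 2).
  have e1 : U k = lam by rewrite -Ur2; congr (U _); lia.
  have e2 : U k.+1 = 1%R by rewrite -Ur1; congr (U _); lia.
  have e3 : U k.+2 = 0%R by rewrite -Ur; congr (U _); lia.
  by constructor 3; apply: (treq h); rewrite ?e1 ?e2 ?e3; ring.
constructor 1; have k3 : k.+1 <= r - 2 by lia.
by apply: (treq (tree_step k3 h)); rewrite /U !chebSS -/U; ring.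
Qed.

Let tree_Rinv x y : tree x y -> signed_tree y (lam * y - x).
Proof.
case=> [||k {}x {}y kr h].
- by constructor 2; apply: (treq tree_e2); ring.
- constructor 1; apply: (treq (tree_step (k := r - 2) _ tree_e1)) => //.
  + by have -> : (r - 2).+1 = r.-1 by [lia]; rewrite Ur1; ring.
  + by have -> : (r - 2) = r.-2 by [lia]; rewrite Ur2; ring.
case: k kr => [|k] kr.
  by constructor 4; apply: (treq h); rewrite ?U2 /U /=; ring.
constructor 1; have k3 : k <= r - 2 by lia.
by apply: (treq (tree_step k3 h)); rewrite /U !chebSS -/U; ring.
Qed.

Let tree_RW x y : tree x y -> tree (x + lam * y) y.
Proof.
move=> h; apply: (treq (tree_step (k := 0) _ h)) => //.
- by rewrite U2 /U /=; ring.
- by rewrite /U /=; ring.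
Qed.

Let tree_RinvW x y : tree x y -> tree x (y + lam * x).
Proof.
move=> h; apply: (treq (tree_step (leqnn _) h)) => //.
- have -> : (r - 2).+2 = r by [lia]; have -> : (r - 2).+1 = r.-1 by [lia].
  by rewrite Ur Ur1; ring.
- have -> : (r - 2).+1 = r.-1 by [lia]; have -> : (r - 2) = r.-2 by [lia].
  by rewrite Ur1 Ur2; ring.
Qed.

Lemma signed_tree_rot x y : signed_tree x y -> signed_tree (lam * x - y) x.
Proof.
case=> h.
- exact: tree_R.
- by apply: (steq (st_opp (tree_R h))); ring.
- by constructor 2; apply: (treq (tree_RW h)); ring.
- by constructor 1; apply: (treq (tree_RW h)); ring.
Qed.

Lemma signed_tree_rotV x y : signed_tree x y -> signed_tree y (lam * y - x).
Proof.
case=> h.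
- exact: tree_Rinv.
- by apply: (steq (st_opp (tree_Rinv h))); ring.
- by constructor 1; apply: (treq (tree_RinvW h)); ring.
- by constructor 2; apply: (treq (tree_RinvW h)); ring.
Qed.

(** Each shear is the rotation or its inverse composed with quarter turns, and [signed_tree] is
    stable under all of these. *)
Lemma orb_signed_tree x y : orb lam x y -> signed_tree x y.
Proof.
elim=> [|[] {}x {}y _ h|[] {}x {}y _ h]; rewrite /sgb.
- by constructor 1; exact: tree_e1.
- by apply: (steq (signed_tree_quarter (signed_tree_rotV h))); ring.
- by apply: (steq (signed_tree_rot (st_opp (signed_tree_quarter h)))); ring.
- by apply: (steq (st_opp (signed_tree_quarter (signed_tree_rot h)))); ring.
- by apply: (steq (signed_tree_rotV (signed_tree_quarter h))); ring.
Qed.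

Let sob_sym x y : small_or_big x y -> small_or_big y x.
Proof.
case=> [[-> ->]|[-> ->]|[h1 [h2 h3]]]; [by constructor 2|by constructor 1|].
by constructor 3; split=> //; split=> //; case: h3; [right|left].
Qed.

Let sob_abs x y : small_or_big x y -> small_or_big (Rabs x) (Rabs y).
Proof.
move=> h; have [hx hy] : (0 <= x)%R /\ (0 <= y)%R.
  by case: h => [[-> ->]|[-> ->]|[h1 [h2 h3]]]; split; lra.
by rewrite !Rabs_pos_eq.
Qed.

Lemma orb_small_or_big x y : orb lam x y -> small_or_big (Rabs x) (Rabs y).
Proof.
move/orb_signed_tree; case=> /tree_small_or_big /sob_abs; rewrite ?Rabs_Ropp //;
  exact: sob_sym.
Qed.

Lemma coxlam_sqr_ge2 : (2 <= lam * lam)%R.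
Proof.
have : (1 <= cheb lam 3)%R by apply: cheb_ge1; lia.
by rewrite !chebSS /=; lra.
Qed.
End Hecke.

(* [x th] and [y th] are the pairings of the orbit vector with the two
   generators *)
Lemma orb_dvd o th p q x y :
  (if o is Some r then 2 < r else true) -> 0 < p -> 0 < q ->
  Rabs th = coxlam o -> orb th x y ->
  (y * th * cheb (y * th) p = 0)%R -> (x * th * cheb (x * th) q = 0)%R ->
  exists2 r, o = Some r & (r %| p) || (r %| q).
Proof.
move=> o2 p0 q0 eth /orb_abs; rewrite eth => ho.
have lam0 : (0 < coxlam o)%R.
  by case: o o2 {eth ho} => [r|] h /=; [apply: coxlam_gt0; lia | lra].
have red z n : (z * th * cheb (z * th) n = 0)%R -> z <> 0%R ->
    cheb (Rabs z * coxlam o) n = 0%R.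
  move=> h z0; rewrite -eth -Rabs_mult; apply: cheb_abs.
  move: h => /Rmult_integral [/Rmult_integral [|e]|] //.
  by move: lam0; rewrite -eth e Rabs_R0; lra.
move=> /red hp /red hq.
have lt2 z n : 0 < n -> cheb (Rabs z * coxlam o) n = 0%R ->
    (Rabs z * coxlam o < 2)%R.
  move=> n0 /(cheb_root_lt2 n0); rewrite Rabs_mult Rabs_Rabsolu.
  by rewrite (Rabs_pos_eq (coxlam o)); lra.
have ge1 (z : Z) : z <> 0%Z -> (1 <= Rabs (IZR z))%R.
  by move=> z0; rewrite -abs_IZR; apply: IZR_le; lia.
case: o o2 eth ho lam0 hp hq lt2 {red} =>
  [r|] o2 eth ho lam0 hp hq lt2; last first.
  (* For [m = oo] the first coordinate is an odd integer, so its pairing has absolute value at least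
     [2]. *)
  have [a [b [ex _]]] := orb2_odd ho.
  have x0 : (2 * a + 1 <> 0)%Z by lia.
  have := ge1 _ x0; have := lt2 _ _ q0 (hq _).
  rewrite ex /coxlam => h1 h2; suff: (Rabs (IZR (2 * a + 1)) * 2 < 2)%R by lra.
  by apply: h1 => /eq_IZR_R0.
exists r => //; apply/orP.
have fin z n : Rabs z = 1%R ->
    (z <> 0%R -> cheb (Rabs z * coxlam (Some r)) n = 0%R) -> r %| n.
  move=> z1 h; apply: cheb_coxlam_dvd; first lia.
  have := h _; rewrite z1 Rmult_1_l; apply.
  by move=> e; move: z1; rewrite e Rabs_R0; lra.
have [r3|r3] := eqVneq r 3.
  subst r; move: ho lt2; rewrite coxlam3 => /orb1_int [a [b [ex ey ab]]] lt2.
  have one (z : Z) n : 0 < n -> z <> 0%Z ->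
      (IZR z <> 0%R -> cheb (Rabs (IZR z) * coxlam (Some 3)) n = 0%R) -> 3 %| n.
    move=> n0 z0 h; apply: (fin _ _ _ h).
    have z0' : IZR z <> 0%R by move/eq_IZR_R0.
    have := lt2 (IZR z) n n0; rewrite -{1}coxlam3 => /(_ (h z0')).
    rewrite -abs_IZR Rmult_1_r => /lt_IZR h2.
    by congr IZR; lia.
  case: (Z.eq_dec b 0) => [b0|b0].
    right; apply: (one a) => //; last by rewrite -ex.
    by move=> a0; apply: ab; rewrite a0 b0.
  by left; apply: (one b) => //; rewrite -ey.
have r4 : 4 <= r by lia.
case: (orb_small_or_big r4 ho) => [[x0 y1]|[x1 y0]|[x1 [y1 big]]].
- by left; apply: fin hp.
- by right; apply: fin hq.
have nz z : (1 <= Rabs z)%R -> z <> 0%R.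
  by move=> h e; move: h; rewrite e Rabs_R0; lra.
have h1 := lt2 _ _ p0 (hp (nz _ y1)); have h2 := lt2 _ _ q0 (hq (nz _ x1)).
by have := coxlam_sqr_ge2 r4; case: big => big; nra.
Qed.

(** * Action of the Artin group by transvections *)

Section Words.
Variables (S : finType) (m : S -> S -> option nat).
Implicit Types (s t : S) (u v w : word S).

Fixpoint altw (k : nat) u v : word S := if k is k'.+1 then u ++ altw k' v u else [::].

Lemma PiS s t k : Pi s t k.+1 = (s, false) :: Pi t s k.
Proof.
rewrite /Pi /mkseq /= (iotaDl 1 0 k) -map_comp; congr cons.
by apply: eq_map => i /=; case: odd.
Qed.

Lemma PiD s t i j :
  Pi s t (i + j) = Pi s t i ++ (if odd i then Pi t s j else Pi s t j).
Proof.
elim: i s t => // i IH s t; rewrite addSn !PiS IH /=.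
by case: odd.
Qed.

Lemma altw_even_cat n u v : altw n.*2 u v ++ u = u ++ altw n.*2 v u.
Proof.
elim: n => [|n IH]; first by rewrite /= cats0.
by rewrite doubleS /= -!catA IH.
Qed.

Lemma wordin_altw X k u v : wordin X u -> wordin X v -> wordin X (altw k u v).
Proof.
elim: k u v => //= k IH u v hu hv.
by rewrite /wordin all_cat; apply/andP; split=> //; exact: IH.
Qed.

Lemma aeq_ctx x y u v : aeq m u v -> aeq m (x ++ u ++ y) (x ++ v ++ y).
Proof.
elim=> {u v} [w|u v _ IH|u v w _ IH1 _ IH2|u a b v|u v s t k st e].
- exact: aeq_refl.
- exact: aeq_sym.
- exact: aeq_trans IH1 IH2.
- by have := aeq_free m (x ++ u) a b (v ++ y); rewrite -!catA.
- by have := aeq_rel (x ++ u) (v ++ y) st e; rewrite -!catA.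
Qed.

Lemma aeq_cat u u' v v' : aeq m u u' -> aeq m v v' -> aeq m (u ++ v) (u' ++ v').
Proof.
move=> h1 h2; apply: aeq_trans (_ : aeq m _ (u' ++ v)) _.
- exact: (aeq_ctx [::] v h1).
- by have := aeq_ctx u' [::] h2; rewrite !cats0.
Qed.

(** Cut the alternating word into blocks of length [k'] and apply the relation to each; for odd [k']
    every other block starts with the other letter, whence the symmetric form of the relation. *)
Lemma aeq_Pi_dvd s t k k' : s != t -> m s t = Some k' -> k' %| k ->
  aeq m (Pi s t k) (Pi t s k).
Proof.
move=> st e /dvdnP [n ->].
have base : aeq m (Pi s t k') (Pi t s k').
  by have := aeq_rel [::] [::] st e; rewrite /= !cats0.
elim: n => [|n IH]; first exact: aeq_refl.
rewrite mulSn !PiD; apply: aeq_cat => //; case: odd => //; exact: aeq_sym.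
Qed.

(** The order on [S] given by [enum_rank] only serves to choose signs that make the form
    alternating. *)
Definition omega s t : R :=
  if s == t then 0%R else
  if enum_rank s < enum_rank t then coxlam (m s t) else (- coxlam (m s t))%R.

(** With [f d] read as the pairing of [d] with a vector, this is the transvection along the
    generator or its inverse. Allowing every function [f] lets its values at two generators be
    prescribed freely, even if the form is degenerate. *)
Definition act (l : letter S) (f : S -> R) : S -> R :=
  fun d => (f d + sgb l.2 * omega d l.1 * f l.1)%R.

Definition actw w (f : S -> R) : S -> R := foldl (fun f l => act l f) f w.

Lemma actw_cat u v f : actw (u ++ v) f = actw v (actw u f).
Proof. by rewrite /actw foldl_cat. Qed.

Lemma omegaii s : omega s s = 0%R.
Proof. by rewrite /omega eqxx. Qed.

Hypothesis hm : coxeter_matrix m.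

Lemma omegaC s t : omega t s = (- omega s t)%R.
Proof.
have [_ [msym _]] := hm; rewrite /omega eq_sym (msym t s).
case: eqVneq => [_|st]; first by ring.
have : enum_rank s != enum_rank t :> nat.
  by apply: contra st => /eqP /val_inj /enum_rank_inj ->.
by case: (ltngtP (enum_rank s) (enum_rank t)) => // _ _; ring.
Qed.

Lemma Rabs_omega s t : s != t -> Rabs (omega s t) = coxlam (m s t).
Proof.
move=> st; have [_ [_ m2]] := hm.
have c0 : (0 <= coxlam (m s t))%R.
  move: (m2 _ _ st); case: (m s t) => [[|[|[|r]]]|] //= h; last lra.
  - by have := coxlam2; rewrite /coxlam /= => ->; lra.
  - by apply: Rlt_le; exact: (@coxlam_gt0 r.+3).
rewrite /omega (negbTE st); case: ltnP => _; rewrite ?Rabs_Ropp; exact: Rabs_pos_eq.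
Qed.

Lemma actK l f : act (l.1, ~~ l.2) (act l f) = f.
Proof.
apply: functional_extensionality => d; rewrite /act /= omegaii.
by case: l.2; rewrite /sgb /=; ring.
Qed.

Lemma actw_inj w f f' : actw w f = actw w f' -> f = f'.
Proof.
elim: w f f' => [|l w IH] f f' //= /IH e.
by rewrite -(actK l f) -(actK l f') e.
Qed.

Lemma actw_altw k u v f : actw (altw k u v) f = alt k (actw u) (actw v) f.
Proof. by elim: k u v f => //= k IH u v f; rewrite actw_cat IH. Qed.

Lemma Pi_altw s t k : Pi s t k = altw k [:: (s, false)] [:: (t, false)].
Proof. by elim: k s t => // k IH s t; rewrite PiS IH. Qed.

Lemma act_pair s t :
  transv_pair (act (s, false)) (act (t, false)) (fun f => f s) (fun f => f t)
    (omega s t).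
Proof.
by split=> f; rewrite /act /= ?omegaii ?(omegaC s t); ring.
Qed.

Lemma act_braid s t k f : s != t -> m s t = Some k ->
  actw (Pi s t k) f = actw (Pi t s k) f.
Proof.
move=> st e; have [_ [_ m2]] := hm.
have k2 : 2 <= k by have := m2 _ _ st; rewrite e.
have ao := Rabs_omega st; rewrite e in ao.
rewrite !Pi_altw !actw_altw; set F := actw [:: (s, _)]; set G := actw [:: (t, _)].
have E : transv_pair F G (fun f => f s) (fun f => f t) (omega s t) := act_pair s t.
(* For [k = 2] the pairing vanishes and the transvections commute; the invariant used below divides
   by the pairing. *)
have [k2'|k2'] := eqVneq k 2.
  have w0 : omega s t = 0%R.
    by case: (Req_dec (omega s t) 0) => // /Rabs_no_R0; rewrite ao k2' coxlam2.
  rewrite k2' /=; apply: functional_extensionality => d.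
  by rewrite /F /G /actw /= /act /= (omegaC s t) w0; ring.
have ch0 : cheb (omega s t) k = 0%R.
  have := cheb_coxlam0 k2; rewrite -ao /Rabs; case: Rcase_abs => // _.
  rewrite cheb_opp => /Rmult_integral [|//].
  by rewrite /sgn_odd; case: odd; lra.
have w0 : omega s t <> 0%R.
  have : (0 < coxlam (Some k))%R by apply: coxlam_gt0; lia.
  by rewrite -ao => h e0; move: h; rewrite e0 Rabs_R0; lra.
have [es et] := alt_braid (k := k) f E (eq_trans (f_equal (Rmult _) ch0) (Rmult_0_r _)).
apply: functional_extensionality => d.
(* [J] corrects coordinate [d] by a combination of coordinates [s] and [t] so as to be fixed by both
   transvections. Agreement at [s] and [t] therefore implies agreement at [d]. *)
pose J (h : S -> R) :=
  (h d - omega d t / omega s t * h s + omega d s / omega s t * h t)%R.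
have JF h : J (F h) = J h.
  rewrite /J /F /actw /= /act /= omegaii (omegaC s t); field; exact: w0.
have JG h : J (G h) = J h.
  rewrite /J /G /actw /= /act /= omegaii; field; exact: w0.
have Jalt n F' G' h : (forall h, J (F' h) = J h) -> (forall h, J (G' h) = J h) ->
    J (alt n F' G' h) = J h.
  by elim: n F' G' h => //= n IH F' G' h h1 h2; rewrite IH.
have := Jalt k F G f JF JG; rewrite -(Jalt k G F f JG JF) /J es et; lra.
Qed.

Lemma actw_aeq u v f : aeq m u v -> actw u f = actw v f.
Proof.
move=> h; elim: h f => {u v} [w|u v _ IH|u v w _ IH1 _ IH2|u a b v|u v s t k st e] f //.
- by rewrite IH1 IH2.
- by rewrite !actw_cat /=; rewrite (actK (a, b)).
- by rewrite !actw_cat act_braid.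
Qed.
End Words.

(** * Transvections along vectors of the plane spanned by two generators *)

Section Plane.
Variables (S : finType) (m : S -> S -> option nat).
Hypothesis hm : coxeter_matrix m.
Variables b c : S.
Local Notation w := (omega m).

Definition transv (x y : R) (f : S -> R) : S -> R :=
  fun d => (f d + (x * w d b + y * w d c) * (x * f b + y * f c))%R.

Lemma transv10 f : transv 1 0 f = act m (b, false) f.
Proof.
by apply: functional_extensionality => d; rewrite /transv /act /sgb /=; ring.
Qed.

(** Conjugating a transvection by a group element moves its vector by that element; each letter of
    [h] contributes one shear, so the vector stays in the orbit. *)
Lemma transv_conj h : wordin [set b; c] h -> exists x y : R, orb (w b c) x y /\
  forall f, actw m h (transv x y f) = act m (b, false) (actw m h f).
Proof.
elim: h => [|[s e] h IH] /=.
  by move=> _; exists 1%R, 0%R; split; [exact: orb_base | exact: transv10].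
case/andP=> hs /IH [x [y [oxy H]]].
move: hs; rewrite !inE => /orP [] /eqP ->.
- exists (x + sgb (~~ e) * w b c * y)%R, y; split; first exact: orb_l.
  move=> f; rewrite -H; congr (actw m h).
  apply: functional_extensionality => d.
  rewrite /transv /act /= !omegaii (omegaC hm b c).
  by case: e; rewrite /sgb /=; ring.
- exists x, (y + sgb e * w b c * x)%R; split; first exact: orb_r.
  move=> f; rewrite -H; congr (actw m h).
  apply: functional_extensionality => d.
  rewrite /transv /act /= !omegaii (omegaC hm b c).
  by case: e; rewrite /sgb /=; ring.
Qed.

(* An odd braid relation [g (bg)^n = (bg)^n b] makes [g] a conjugate of [b]
   inside [A_{b,c}]. *)
Lemma odd_braid_transv g p : odd p -> wordin [set b; c] g ->
  aeq m (altw p g [:: (b, false)]) (altw p [:: (b, false)] g) ->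
  exists x y : R, orb (w b c) x y /\ forall f, actw m g f = transv x y f.
Proof.
move=> op hg hrel.
have hb : wordin [set b; c] [:: (b, false)] by rewrite /= !inE eqxx.
pose h := altw p./2.*2 [:: (b, false)] g.
have [x [y [oxy H]]] := @transv_conj h (wordin_altw _ hb hg).
exists x, y; split=> // f; apply: (@actw_inj _ m h).
rewrite H -actw_cat.
have -> : act m (b, false) (actw m h f) = actw m (h ++ [:: (b, false)]) f.
  by rewrite actw_cat.
apply: actw_aeq => //; rewrite /h altw_even_cat.
by move: hrel; rewrite -{1 2}(odd_double_half p) op add1n.
Qed.

(** The form on the plane is the determinant of the coordinates times [w b c]. *)
Lemma transv_pair_plane x y s (z1 z2 : R) :
  (forall f : S -> R, act m (s, false) f = transv z1 z2 f) ->
  transv_pair (transv x y) (act m (s, false))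
    (fun f => x * f b + y * f c)%R (fun f => z1 * f b + z2 * f c)%R
    ((x * z2 - y * z1) * w b c)%R.
Proof.
move=> H; split=> f; rewrite ?H /transv !omegaii (omegaC hm b c); ring.
Qed.

End Plane.

(** * Consequences of the existence of retractions *)

(** The word [g] represents the image of [a]; since each [s] in [X] is its own image, the relations
    between [a] and [s] carry over to [g]. *)
Lemma retraction_image (S : finType) (m : S -> S -> option nat) (X : {set S})
    (a : S) : retraction m (a |: X) X ->
  exists2 g, wordin X g & forall s k, s \in X -> a != s -> m a s = Some k ->
    aeq m (altw k g [:: (s, false)]) (altw k [:: (s, false)] g).
Proof.
case=> f [f_aeq [f_cat [f_in f_id]]].
have aY : wordin (a |: X) [:: (a, false)] by rewrite /= !inE eqxx.
have [g [hg fg]] := f_in _ aY; exists g => // s k sX as_ e.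
have sY : wordin (a |: X) [:: (s, false)] by rewrite /= !inE sX orbT.
have f_altw n u v u' v' : wordin (a |: X) u -> wordin (a |: X) v ->
    aeq m (f u) u' -> aeq m (f v) v' -> aeq m (f (altw n u v)) (altw n u' v').
  elim: n u v u' v' => [|n IH] u v u' v' hu hv hu' hv' /=; first exact: f_id.
  apply: aeq_trans (f_cat _ _ hu (wordin_altw _ hv hu)) _.
  by apply: aeq_cat => //; exact: IH.
have fs : aeq m (f [:: (s, false)]) [:: (s, false)] by apply: f_id; rewrite /= sX.
apply: aeq_trans (aeq_sym (f_altw k _ _ _ _ aY sY fg fs)) _.
apply: aeq_trans (f_altw k _ _ _ _ sY aY fs fg).
apply: f_aeq; try exact: wordin_altw.
by rewrite -!Pi_altw; apply: (aeq_Pi_dvd as_ e).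
Qed.

Lemma retraction_triple_dvd (S : finType) (m : S -> S -> option nat)
    (a b c : S) p q :
  coxeter_matrix m -> a != b -> a != c -> b != c ->
  retraction m [set a; b; c] [set b; c] ->
  m a b = Some p -> odd p -> m a c = Some q ->
  exists2 r, m b c = Some r & (r %| p) || (r %| q).
Proof.
move=> hm ab ac bc; have -> : [set a; b; c] = a |: [set b; c] by rewrite setUA.
case/retraction_image=> g hg hrel ep op eq.
have [_ [msym m2]] := hm.
have p2 : 2 <= p by have := m2 _ _ ab; rewrite ep.
have q2 : 2 <= q by have := m2 _ _ ac; rewrite eq.
have bX : b \in [set b; c] by rewrite !inE eqxx.
have cX : c \in [set b; c] by rewrite !inE eqxx orbT.
have relb := hrel _ _ bX ab ep; have relc := hrel _ _ cX ac eq.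
have [x [y [oxy eg]]] := odd_braid_transv hm op hg relb.
have {}eg : actw m g = transv m b c x y by apply: functional_extensionality.
pose db d : R := if d == b then 1%R else 0%R.
pose dc d : R := if d == c then 1%R else 0%R.
(* If [b] and [c] commute, the orbit is a single point. Were [q] odd as well, [g] would act both as
   [b] and as [c]; comparing the values at [a] on [db] gives [omega m a b = 0], against [p >= 3]. *)
have [e2|n2] := eqVneq (m b c) (Some 2).
  exists 2 => //; rewrite !dvdn2 op /=; apply/negP => oq.
  have hg' : wordin [set c; b] g by rewrite setUC.
  have [x' [y' [oxy' eg']]] := odd_braid_transv hm oq hg' relc.
  have w0 : omega m b c = 0%R.
    case: (Req_dec (omega m b c) 0) => // /Rabs_no_R0.
    by rewrite Rabs_omega // e2 coxlam2.
  have w0' : omega m c b = 0%R by rewrite (omegaC hm b c) w0; ring.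
  move: oxy oxy'; rewrite w0 w0' => /orb0E [xE yE] /orb0E [xE' yE'].
  have := eg' db; rewrite eg xE yE xE' yE' !transv10 => /(f_equal (fun f => f a)).
  rewrite /act /= /db eqxx [c == b]eq_sym (negbTE bc) => h.
  have {}h : omega m a b = 0%R by lra.
  have := coxlam_gt0 p2; rewrite -ep -(Rabs_omega hm ab) h Rabs_R0.
  have p3 : 2 < p by move: p2 op; case: (p) => [|[|[|]]].
  by move=> /(_ p3); lra.
have o2 : (if m b c is Some r then 2 < r else true) : bool.
  move: n2 (m2 _ _ bc); case: (m b c) => // r n2 r2.
  by have : r != 2 by [apply: contraNneq n2 => ->]; lia.
have p0 : 0 < p by lia.
have q0 : 0 < q by lia.
apply: (orb_dvd o2 p0 q0 (Rabs_omega hm bc) oxy).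
- have Hb f : act m (b, false) f = transv m b c 1 0 f by rewrite transv10.
  have := alt_agree (k := p) (v := db) (transv_pair_plane hm x y Hb).
  rewrite -eg => /(_ _ _); have := actw_aeq hm db relb; rewrite !actw_altw => e /(_ e).
  rewrite /db eqxx [c == b]eq_sym (negbTE bc) => /(_ _) h.
  have {h} := h ltac:(lra).
  (* The sign is harmless, because [cheb] of odd index is an even function. *)
  have -> : ((x * 0 - y * 1) * omega m b c = - (y * omega m b c))%R by ring.
  rewrite cheb_opp /sgn_odd op; lra.
- have Hc f : act m (c, false) f = transv m b c 0 1 f.
    by apply: functional_extensionality => d; rewrite /transv /act /sgb /=; ring.
  have := alt_agree (k := q) (v := dc) (transv_pair_plane hm x y Hc).
  rewrite -eg => /(_ _ _); have := actw_aeq hm dc relc; rewrite !actw_altw => e /(_ e).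
  rewrite /dc eqxx (negbTE bc) => /(_ _) h.
  have {h} := h ltac:(lra).
  by have -> : ((x * 1 - y * 0) * omega m b c = x * omega m b c)%R by ring.
Qed.

(** * Retractions by substitution of letters *)

Section Substitution.
Variables (S : finType) (m : S -> S -> option nat).
Implicit Types (rho : S -> option S) (X Y : {set S}).

Definition substw rho (w : word S) : word S :=
  pmap (fun l => omap (fun t => (t, l.2)) (rho l.1)) w.

(** These conditions make the substitution respect each relation: two surviving letters need
    equality or a braid relation of dividing length, and a letter facing an erased one occurs
    equally often on both sides when [k] is even. *)
Definition admissible Y rho : Prop :=
  forall s t k, s \in Y -> t \in Y -> s != t -> m s t = Some k ->
    match rho s, rho t with
    | Some x, Some y => x = y \/ exists2 k', m x y = Some k' & k' %| k
    | None, None => True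
    | _, _ => ~~ odd k
    end.

Definition retracting Y X rho : Prop :=
  [/\ admissible Y rho, forall s, s \in X -> rho s = Some s &
      forall s, s \in Y -> if rho s is Some x then x \in X else true].

Lemma substw_cat rho u v : substw rho (u ++ v) = substw rho u ++ substw rho v.
Proof. exact: pmap_cat. Qed.

Lemma substw_Pi rho s t k : substw rho (Pi s t k) =
  match rho s, rho t with
  | Some x, Some y => Pi x y k
  | Some x, None => nseq (uphalf k) (x, false)
  | None, Some y => nseq k./2 (y, false)
  | None, None => [::]
  end.
Proof.
elim: k s t => [|k IH] s t; first by case: (rho s) => [x|]; case: (rho t).
rewrite PiS /substw /= -/(substw _ _) IH.
by case: (rho s) => [x|]; case: (rho t) => [y|] //=; rewrite PiS.
Qed.

Lemma substw_aeq rho u v : admissible [set: S] rho ->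
  aeq m u v -> aeq m (substw rho u) (substw rho v).
Proof.
move=> ok; elim=> {u v} [w|u v _|u v w _ h1 _ h2|u x b v|u v s t k st e].
- exact: aeq_refl.
- exact: aeq_sym.
- exact: aeq_trans h1 h2.
- rewrite !substw_cat /substw /=; case: (rho x) => [y|] /=; first exact: aeq_free.
  exact: aeq_refl.
rewrite !substw_cat; apply: (aeq_ctx _ _ _); rewrite !substw_Pi.
have := ok s t k (in_setT _) (in_setT _) st e.
case: (rho s) => [x|]; case: (rho t) => [y|] h.
- case: (eqVneq x y) h => [-> _|xy]; first exact: aeq_refl.
  by case=> [/eqP|[k' e' d]]; [rewrite (negbTE xy) | exact: aeq_Pi_dvd xy e' d].
- by rewrite uphalf_half (negbTE h); exact: aeq_refl.
- by rewrite uphalf_half (negbTE h); exact: aeq_refl.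
- exact: aeq_refl.
Qed.

Lemma retracting_retraction X rho :
  retracting [set: S] X rho -> retraction m [set: S] X.
Proof.
case=> ok rid rX; exists (substw rho); split; first by move=> u v _ _; exact: substw_aeq.
split; first by move=> u v _ _; rewrite substw_cat; exact: aeq_refl.
split=> u.
  move=> _; exists (substw rho u); split; last exact: aeq_refl.
  elim: u => [|[s e] u IH] //; rewrite /substw /=; have := rX s (in_setT _).
  by case: (rho s) => //= x ->.
move=> hu; suff -> : substw rho u = u by exact: aeq_refl.
elim: u hu => [|[s e] u IH] //= /andP [sX /IH {}IH].
by rewrite /substw /= rid //= -/(substw _ _) IH.
Qed.

Lemma retracting_comp Z Y X rho1 rho2 : X \subset Y ->
  retracting Z Y rho1 -> retracting Y X rho2 ->
  retracting Z X (fun s => obind rho2 (rho1 s)).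
Proof.
move=> XY [ok1 id1 in1] [ok2 id2 in2]; split.
- move=> s t k sZ tZ st e; move: (ok1 _ _ _ sZ tZ st e) (in1 _ sZ) (in1 _ tZ).
  case: (rho1 s) => [x|]; case: (rho1 t) => [y|] //= h.
  + move=> xY yY; case: (eqVneq x y) h => [-> _|xy].
      by case: (rho2 y) => //; left.
    case=> [/eqP|[k' e' d]]; first by rewrite (negbTE xy).
    have := ok2 _ _ _ xY yY xy e'.
    (* A letter erased only by the second map needs [k] even, which follows from [k'] even and [k']
       dividing [k]. *)
    have ev : ~~ odd k' -> ~~ odd k by move: d; rewrite -!dvdn2 => d /dvdn_trans; apply.
    case: (rho2 x) => [x'|]; case: (rho2 y) => [y'|] //; case; first by left.
    by case=> k'' e'' d'; right; exists k'' => //; exact: dvdn_trans d' d.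
  + by case: (rho2 x).
  + by case: (rho2 y).
- by move=> s sX; rewrite id1 /= ?id2 //; exact: (subsetP XY).
- move=> s sZ; have := in1 _ sZ; case: (rho1 s) => //= x; exact: in2.
Qed.

Hypothesis hm : coxeter_matrix m.

(** Divisibility is demanded only for [b] with [p] minimal among the odd labels at [a]: this is the
    [b] that replaces [a]. *)
Lemma retracting_step X a : a \notin X ->
  (forall b c, a != b -> a != c -> b != c -> b \in X -> c \in X ->
    forall p q, m a b = Some p -> odd p -> m a c = Some q ->
    (forall x k, x \in X -> m a x = Some k -> odd k -> p <= k) ->
    exists2 r, m b c = Some r & r %| q) ->
  exists rho, retracting (a |: X) X rho.
Proof.
move=> aX H; have [_ [msym _]] := hm.
have neq s : s \in X -> a != s by move=> sX; apply: contraNneq aX => ->.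
pose P x := (x \in X) && (if m a x is Some k then odd k else false).
have [x0 Px0|noP] := pickP P; last first.
  have ev x k : x \in X -> m a x = Some k -> ~~ odd k.
    by move=> xX e; move: (noP x); rewrite /P xX e /= => ->.
  exists (fun s => if s \in X then Some s else None); split.
  - move=> s t k; rewrite !inE => /orP [/eqP ->|sX] /orP [/eqP ->|tX] st e.
    + by rewrite (negbTE aX).
    + by rewrite (negbTE aX) tX; exact: ev tX e.
    + by rewrite (negbTE aX) sX; apply: (ev s) => //; rewrite msym.
    + by rewrite sX tX; right; exists k.
  - by move=> s ->.
  - by move=> s _; case E: (s \in X).
(* The default [0] never enters the minimum, since [P] holds only at finite labels. *)
pose val x := if m a x is Some k then k else 0.
case: (arg_minnP val Px0) => b /andP [bX]; case Eb: (m a b) => [p|] // op bmin.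
have bmin' x k : x \in X -> m a x = Some k -> odd k -> p <= k.
  by move=> xX e ok; have := bmin x; rewrite /P /val xX e ok Eb => ->.
have key t k : t \in X -> m a t = Some k ->
    b = t \/ exists2 k', m b t = Some k' & k' %| k.
  move=> tX e; have [->|bt] := eqVneq b t; [by left | right].
  by apply: (H b t (neq _ bX) (neq _ tX) bt bX tX p k).
exists (fun s => if s \in X then Some s else Some b); split.
- move=> s t k; rewrite !inE => /orP [/eqP ->|sX] /orP [/eqP ->|tX] st e.
  + by rewrite (negbTE aX); left.
  + by rewrite (negbTE aX) tX; exact: key.
  + rewrite (negbTE aX) sX; case: (key s k sX); first by rewrite msym.
      by left.
    by rewrite msym; right.
  + by rewrite sX tX; right; exists k.
- by move=> s ->.
- by move=> s _; case E: (s \in X).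
Qed.

(** Induction on the size of the complement of [X], composing one-element retractions. *)
Lemma retracting_all :
  (forall X a, a \notin X -> exists rho, retracting (a |: X) X rho) ->
  forall X, exists rho, retracting [set: S] X rho.
Proof.
move=> H X; elim: {X}_.+1 {-2}X (ltnSn #|~: X|) => // n IH X.
have [a aX|X0] := pickP [pred a | a \notin X]; last first.
  have -> : X = [set: S] by apply/setP => s; have := X0 s; rewrite !inE /= => /negbFE.
  move=> _; exists Some; split=> // s t k _ _ _ e; right; by exists k.
rewrite ltnS => hn; have [rho2 h2] := H X a aX.
have [|rho1 h1] := IH (a |: X).
  apply: leq_trans hn; apply: proper_card; rewrite properE setCS subsetU1.
  by rewrite setCS; apply: contra aX => /subsetP; apply; rewrite setU11.
by exists (fun s => obind rho2 (rho1 s)); apply: retracting_comp h1 h2; exact: subsetU1.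
Qed.
End Substitution.

Theorem theorem1p1 (S : finType) (m : S -> S -> option nat) :
  coxeter_matrix m ->
  (parabolic_retractable m <->
   (forall a b c : S, a != b -> a != c -> b != c ->
      retraction m [set a; b; c] [set b; c])).
Proof.
move=> hm; split=> [H a b c _ _ _|H X].
  have [f [f_aeq [f_cat [f_in f_id]]]] := H [set b; c].
  have inT u : wordin [set: S] u by apply/allP => l _; rewrite inE.
  by exists f; split; [|split; [|split]] => * //; auto.
have [_ [msym _]] := hm.
have dvd a b c p q ab ac bc :=
  @retraction_triple_dvd S m a b c p q hm ab ac bc (H a b c ab ac bc).
suff [rho h] : exists rho, retracting m [set: S] X rho by exact: retracting_retraction h.
apply: retracting_all => {}X a aX; apply: retracting_step => //.
move=> b c ab ac bc bX cX p q ep op eq pmin.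
have [r er /orP [rp|rq]] := dvd _ _ _ _ _ ab ac bc ep op eq; exists r => //.
have or : odd r by move: op; apply: contraTT; rewrite -!dvdn2 => /dvdn_trans; apply.
(* If [r] divides [p], the triple with [a] and [b] exchanged gives that [q] divides [p] or [r],
   hence [p]. So [q] is odd, and minimality of [p] yields [q = p], a multiple of [r]. *)
have ba : b != a by rewrite eq_sym.
have epb : m b a = Some p by rewrite msym.
have [q' eq' hq] := dvd _ _ _ _ _ ba bc ac epb op er.
move: eq'; rewrite eq => -[eqq]; subst q'.
have qp : q %| p by case/orP: hq => // /dvdn_trans; apply.
have oq : odd q by move: op; apply: contraTT; rewrite -!dvdn2 => /dvdn_trans; apply.
have pq := pmin _ _ cX eq oq.
have qp' : q <= p by apply: dvdn_leq => //; case: (p) op.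
by have -> : q = p by apply/eqP; rewrite eqn_leq pq qp'.
Qed.
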